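(* Let $d\ge3$, $q>d/(d-1)$ and $r\in(0,1)$. Suppose that Bernoulli-$r$ bond percolation on $\mathbb{Z}^d$ has, with positive probability, a root component carrying a finite $q$-energy unit flow from the root to infinity. In the square-bypass repair model under Bernoulli-$p$ physical edge failures, if $$1-(1-p)(1-p^3)^{2(d-1)}\ge\rho(R_d,r),$$ then the surviving locally repaired physical network supports a finite $q$-energy unit flow with positive probability. For the lifted flow $\Theta$ of a finite $q$-energy unit flow $\theta$ on the dominated Bernoulli-$r$ demand component $D$, $$\mathcal{E}^q_H(\Theta)\le3\,K_d^{\,q-1}\,\mathcal{E}^q_D(\theta).$$
   Context: Flows are antisymmetric functions on oriented edges. A unit flow from a root $o$ to infinity is a flow $\theta$ with $\operatorname{div}\theta(o)=1$ and $\operatorname{div}\theta(x)=0$ for $x\ne o$, where $\operatorname{div}\theta(x)=\sum_{y\sim x}\theta(x,y)$. The $q$-energy on a graph $X$ is $\mathcal{E}^q_X(\theta)=\sum_{e\in E_X}|\theta(e)|^q$ over unoriented edges. Square-bypass repair model: the demand network is $\mathbb{Z}^d$ with nearest-neighbour edges (with a fixed root), and the physical network $H$ is a copy of $\mathbb{Z}^d$ with nearest-neighbour edges, the terminals being embedded identically. For a demand edge $e=\{x,x+e_i\}$ ($e_1,\dots,e_d$ the standard basis vectors) the candidate routes are: (a) the direct physical edge $\{x,x+e_i\}$; (b) for each $j\ne i$ and $\sigma\in\{-1,1\}$, the length-three path $x\to x+\sigma e_j\to x+e_i+\sigma e_j\to x+e_i$. Each physical edge is independently open with probability $p$; the surviving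 physical network consists of the open edges. $Y_e=1$ if at least one candidate route of $e$ is entirely open, and $Y_e=0$ otherwise. A field $(Y_e)$ is $R$-dependent if its restrictions to any two edge sets at edge-distance greater than $R$ are independent. $R_d<\infty$ denotes a deterministic number such that the repairability field $(Y_e)$ of the square-bypass model is $R_d$-dependent. For $R<\infty$ and $r\in(0,1)$, $\rho(R,r)<1$ is a (Liggett–Schonmann–Stacey) threshold such that every $R$-dependent $\{0,1\}$-valued field on the edges of $\mathbb{Z}^d$ with all marginals $\mathbb{P}(Y_e=1)\ge\rho(R,r)$ stochastically dominates independent Bernoulli-$r$ bond percolation. Put $$K_d=\sup_{a\in E_H}\#\{e:\ a\text{ belongs to at least one candidate route for }e\}<\infty.$$ Under domination, $(Y_e)$ is coupled with an independent Bernoulli-$r$ field $(\omega_e)$ so that $\omega_e\le Y_e$ for all $e$ almost surely; $D$ is the component of the root in $\{e:\omega_e=1\}$, with edge set $F_D$. For each $e\in F_D$ select an open candidate route $\gamma_e$. The lift of a flow $\theta$ on $D$ is $\Theta=\sum_{e\in F_D}\theta(e)\eta_e$, where $e$ and $\gamma_e$ are consistently oriented and $\eta_e$ is the unit path flow along $\gamma_e$ ($1$ on edges traversed in the direction of $\gamma_e$, $-1$ on reversed edges, $0$ elsewhere). *)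

(* Defs.v *)
From Stdlib Require Import Relations.
From HB Require Import structures.
From mathcomp Require Import all_boot all_order all_algebra.
From mathcomp Require Import finmap.
From mathcomp Require Import all_classical all_reals all_analysis.
Set Implicit Arguments.
Unset Strict Implicit.
Unset Printing Implicit Defensive.
Import Order.TTheory GRing.Theory Num.Theory.
Local Open Scope classical_set_scope.
Local Open Scope ring_scope.

Definition vertex (d : nat) := 'rV[int]_d.

Definition evec (d : nat) (i : 'I_d) : vertex d := delta_mx 0 i.

(* The pair (x, i) stands for the unoriented edge {x, x + e_i}; every
   nearest-neighbour edge of Z^d is represented exactly once. *)
Definition zedge (d : nat) := (vertex d * 'I_d)%type.

Definition etail (d : nat) (e : zedge d) : vertex d := e.1.
Definition ehead (d : nat) (e : zedge d) : vertex d := e.1 + evec e.2.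

Definition joins (d : nat) (e : zedge d) (x y : vertex d) : Prop :=
  (x = etail e /\ y = ehead e) \/ (x = ehead e /\ y = etail e).

(* A subgraph of Z^d is given by its set F of edges. *)
Definition adj (d : nat) (F : set (zedge d)) (x y : vertex d) : Prop :=
  exists2 e, F e & joins e x y.

Definition component (d : nat) (F : set (zedge d)) (o : vertex d) :
    set (zedge d) :=
  [set e | F e /\ clos_refl_trans (vertex d) (adj F) o (etail e)].

Definition is_flow (R : realType) (d : nat) (F : set (zedge d))
    (theta : vertex d -> vertex d -> R) : Prop :=
  (forall x y, theta y x = - theta x y) /\
  (forall x y, ~ adj F x y -> theta x y = 0).

Definition divergence (R : realType) (d : nat) (F : set (zedge d))
    (theta : vertex d -> vertex d -> R) (x : vertex d) : R :=
  \sum_(y \in [set y | adj F x y]) theta x y.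

Definition unit_flow (R : realType) (d : nat) (F : set (zedge d))
    (o : vertex d) (theta : vertex d -> vertex d -> R) : Prop :=
  [/\ is_flow F theta,
      divergence F theta o = 1 &
      forall x, x != o -> divergence F theta x = 0].

Definition energy (R : realType) (d : nat) (q : R) (F : set (zedge d))
    (theta : vertex d -> vertex d -> R) : \bar R :=
  \esum_(e in F) (`|theta (etail e) (ehead e)| `^ q)%:E.

Definition finite_energy_unit_flow (R : realType) (d : nat) (q : R)
    (F : set (zedge d)) (o : vertex d)
    (theta : vertex d -> vertex d -> R) : Prop :=
  unit_flow F o theta /\ (energy q F theta < +oo)%E.

Definition carries_flow (R : realType) (d : nat) (q : R) (o : vertex d)
    (F : set (zedge d)) : Prop :=
  exists theta, finite_energy_unit_flow q F o theta.

Definition open_edges (d : nat) (T : Type) (X : zedge d -> T -> bool) (w : T) :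
    set (zedge d) := [set e | X e w].

Definition measurable_field (d : nat) (dT : measure_display)
    (T : measurableType dT) (X : zedge d -> T -> bool) : Prop :=
  forall e, measurable_fun setT (X e).

Definition mutually_independent (R : realType) (I : choiceType)
    (dT : measure_display) (T : measurableType dT) (P : probability T R)
    (A : I -> set T) : Prop :=
  forall s : {fset I},
    P (\bigcap_(i in [set` s]) A i) = (\prod_(i <- s) P (A i))%E.

(* Independent Bernoulli-p field. Independence of the events {X_e = 1} is
   independence of the {0,1}-valued variables X_e. *)
Definition bernoulli_field (R : realType) (d : nat) (dT : measure_display)
    (T : measurableType dT) (P : probability T R) (p : R)
    (X : zedge d -> T -> bool) : Prop :=
  [/\ measurable_field X,
      forall e, P [set w | X e w] = p%:E &
      mutually_independent P (fun e => [set w | X e w])].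

Definition field_sigma (d : nat) (T : Type) (X : zedge d -> T -> bool)
    (S : set (zedge d)) : set (set T) :=
  <<s [set [set w | X e w] | e in S] >>.

(* Distance between edges is the graph distance in the line graph of Z^d:
   [edge_within n e f] says that it is at most n. *)
Definition touch (d : nat) (e f : zedge d) : Prop :=
  [\/ etail e = etail f, etail e = ehead f, ehead e = etail f | ehead e = ehead f].

Fixpoint edge_within (d : nat) (n : nat) (e f : zedge d) : Prop :=
  if n is n'.+1 then
    edge_within n' e f \/ (exists2 g, edge_within n' e g & touch g f)
  else e = f.

Definition dependent_range (R : realType) (d : nat) (dT : measure_display)
    (T : measurableType dT) (P : probability T R) (k : nat)
    (X : zedge d -> T -> bool) : Prop :=
  forall S1 S2 : set (zedge d),
    (forall e f, S1 e -> S2 f -> ~ edge_within k e f) ->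
  forall U V : set T, field_sigma X S1 U -> field_sigma X S2 V ->
    P (U `&` V) = (P U * P V)%E.

(* The product sigma-algebra of the configuration space {0,1}^E. *)
Definition config_event (d : nat) : set (set (zedge d -> bool)) :=
  <<s [set [set c : zedge d -> bool | c e] | e in [set: zedge d]] >>.

Definition increasing_event (d : nat) (A : set (zedge d -> bool)) : Prop :=
  forall c c' : zedge d -> bool, (forall e, c e -> c' e) -> A c -> A c'.

(* The law of Y under P stochastically dominates the law of X under Q. *)
Definition stoch_dominates (R : realType) (d : nat)
    (dT : measure_display) (T : measurableType dT) (P : probability T R)
    (Y : zedge d -> T -> bool)
    (dS : measure_display) (S : measurableType dS) (Q : probability S R)
    (X : zedge d -> S -> bool) : Prop :=
  forall A, config_event A -> increasing_event A ->
    (Q [set w | A (fun e => X e w)] <= P [set w | A (fun e => Y e w)])%E.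

Definition lss_threshold (R : realType) (d k : nat) (r rho : R) : Prop :=
  rho < 1 /\
  forall (dT : measure_display) (T : measurableType dT) (P : probability T R)
    (Y : zedge d -> T -> bool),
    measurable_field Y -> dependent_range P k Y ->
    (forall e, (rho%:E <= P [set w | Y e w])%E) ->
  forall (dS : measure_display) (S : measurableType dS) (Q : probability S R)
    (X : zedge d -> S -> bool),
    bernoulli_field Q r X -> stoch_dominates P Y Q X.

(* Inner formulation, so that no measurability of A is presupposed: the value
   of P on a non-measurable set carries no information. For measurable A this
   is 0 < P A. *)
Definition with_positive_probability (R : realType) (dT : measure_display)
    (T : measurableType dT) (P : probability T R) (A : set T) : Prop :=
  exists B, [/\ measurable B, B `<=` A & (0 < P B)%E].

(* A route is the list of its successive vertices. *)
Definition route (d : nat) := seq (vertex d).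

Definition steps (d : nat) (g : route d) : seq (vertex d * vertex d) :=
  zip g (behead g).

Definition direct_route (d : nat) (e : zedge d) : route d :=
  [:: etail e; ehead e].

Definition bypass_route (d : nat) (e : zedge d) (j : 'I_d) (sigma : int) :
    route d :=
  [:: etail e; etail e + sigma *: evec j; ehead e + sigma *: evec j; ehead e].

Definition candidate (d : nat) (e : zedge d) (g : route d) : Prop :=
  g = direct_route e \/
  exists j sigma,
    [/\ j != e.2, sigma = 1 \/ sigma = -1 & g = bypass_route e j sigma].

Definition belongs (d : nat) (a : zedge d) (g : route d) : Prop :=
  exists2 s, s \in steps g & joins a s.1 s.2.

Definition route_open (d : nat) (F : set (zedge d)) (g : route d) : Prop :=
  forall a, belongs a g -> F a.

Definition repairable (d : nat) (T : Type) (opn : zedge d -> T -> bool)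
    (e : zedge d) (w : T) : bool :=
  `[< exists2 g, candidate e g & route_open (open_edges opn w) g >].

Definition Kd (R : realType) (d : nat) : R :=
  fine (ereal_sup (range (fun a : zedge d =>
    @counting _ R [set e | exists2 g, candidate e g & belongs a g]))).

Definition path_flow (R : realType) (d : nat) (g : route d)
    (u v : vertex d) : R :=
  ((u, v) \in steps g)%:R - ((v, u) \in steps g)%:R.

(* Candidate routes run from etail e to ehead e, so theta is evaluated in that
   direction. For each (u, v) only finitely many terms are nonzero. *)
Definition lift_flow (R : realType) (d : nat) (F : set (zedge d))
    (gamma : zedge d -> route d) (theta : vertex d -> vertex d -> R)
    (u v : vertex d) : R :=
  \sum_(e \in F) theta (etail e) (ehead e) * path_flow R (gamma e) u v.

(* Main.v *)
Require Import Defs.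
From HB Require Import structures.
From mathcomp Require Import all_boot all_order all_algebra.
From mathcomp Require Import finmap zify ring.
From mathcomp Require Import all_classical all_reals all_analysis.
Set Implicit Arguments.
Unset Strict Implicit.
Unset Printing Implicit Defensive.
Import Order.TTheory GRing.Theory Num.Theory.
Import numFieldNormedType.Exports.
Local Open Scope classical_set_scope.
Local Open Scope ring_scope.

(** The event A that an edge configuration carries a finite-energy unit flow is
increasing, and it has positive probability for Bernoulli-r percolation because
a flow on the root component is a flow on the whole open subgraph. The candidate
routes of a demand edge have pairwise disjoint edge sets, so the edge fails to
be repairable with probability exactly (1 - p) (1 - p^3)^(2 (d - 1))
([probability_repairable]). The hypothesis on p therefore puts the repairability
field above the domination threshold, and A has positive probability for the
repairable configuration as well. A flow on the repairable edges becomes a flow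
on open physical edges by replacing each demand edge with an open route
([repair_carries_flow]).

Lifting preserves the divergence, because a route has the same endpoints as the
edge that it replaces ([lift_divergence]). For the energy, at most K_d demand
edges contribute to a given physical edge, so convexity of the q-th power costs
a factor K_d^(q - 1) ([lift_powR_le]); every demand edge is then counted once
for each edge of its route, that is, at most 3 times ([lift_energy]). This
estimate is deterministic: it holds for every subgraph and every choice of
candidate routes.

Stochastic domination only compares probabilities of measurable events, so the
remaining point is that A belongs to the product sigma-algebra
([config_event_carries_flow]). A is the union over integers M of the events A_M
that there is a unit flow of energy at most M. By compactness, A_M occurs as
soon as, for every n, it occurs after opening all but the first n edges: a limit
along an ultrafilter of the corresponding flows is a unit flow of energy at most
M supported on the original configuration ([bounded_flow_limit]). Since A_M is
increasing, the converse is clear, and A_M is a countable intersection of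
cylinder events. *)

(** * Edges and neighbours in the lattice *)

Section Geometry.
Variable d : nat.
Implicit Types (x y u v : vertex d) (a e : zedge d) (i j k : 'I_d).

Lemma evecE i j : evec i 0 j = (j == i)%:R.
Proof. by rewrite mxE eqxx. Qed.

Lemma evec_inj : injective (@evec d).
Proof.
move=> i j /(congr1 (fun M : 'rV[int]_d => M 0 i)).
by rewrite !evecE eqxx; case: eqP.
Qed.

(** This excludes that an edge and another one traversed backwards coincide,
so that the pairs (x, i) represent the unoriented edges faithfully. *)
Lemma evecD_neq0 i j : evec i + evec j != 0.
Proof.
apply/eqP => /(congr1 (fun M : 'rV[int]_d => M 0 i)).
by rewrite !mxE !eqxx; case: eqP.
Qed.

Lemma evecN_neq i j : evec i != - evec j.
Proof. by rewrite -subr_eq0 opprK evecD_neq0. Qed.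

Lemma joins_etail_ehead a : joins a (etail a) (ehead a).
Proof. by left. Qed.

Lemma joins_sym a u v : joins a u v -> joins a v u.
Proof. by case=> -[-> ->]; [right|left]. Qed.

Lemma joins_uniq a e u v : joins a u v -> joins e u v -> a = e.
Proof.
case: a => x i; case: e => y j; rewrite /joins /etail /ehead /=.
have crossed x' i' j' : x' = x' + evec i' + evec j' -> False.
  move=> h; have /eqP[] := evecD_neq0 i' j'.
  by apply: (addrI x'); rewrite addr0 addrA -h.
case=> -[-> ->] [] [].
- by move=> -> /addrI/evec_inj ->.
- by move=> ex h; case: (crossed y j i); rewrite -ex h.
- by move=> h ex; case: (crossed y j i); rewrite -ex h.
- by move=> h ex; move: h; rewrite ex => /addrI/evec_inj ->.
Qed.

Lemma adj_edge (F : set (zedge d)) a : adj F (etail a) (ehead a) -> F a.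
Proof. by case=> e Fe je; rewrite (joins_uniq (joins_etail_ehead a) je). Qed.

(** A duplicate-free list, so that the sum over adjacent vertices in the
divergence becomes an ordinary big sum which can be exchanged with others. *)
Definition neighbours x : seq (vertex d) :=
  [seq x + evec k | k : 'I_d] ++ [seq x - evec k | k : 'I_d].

Lemma neighbours_uniq x : uniq (neighbours x).
Proof.
have injD : injective (fun k => x + evec k) by move=> i j /addrI/evec_inj.
have injB : injective (fun k => x - evec k).
  by move=> i j /addrI/oppr_inj/evec_inj.
rewrite cat_uniq (map_inj_uniq injD) (map_inj_uniq injB) enum_uniq.
rewrite andbT /=.
apply/hasPn => _ /mapP[k _ ->]; apply/mapP => -[i _ /= h].
by have /eqP[] := evecN_neq i k; apply: (addrI x); rewrite -h.
Qed.

Lemma neighboursP x y : reflect (exists a, joins a x y) (y \in neighbours x).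
Proof.
rewrite mem_cat; apply: (iffP orP).
  case=> /mapP[k _ ->]; first by exists (x, k); left.
  by exists (x - evec k, k); right; rewrite /ehead /= subrK.
case=> -[z k]; rewrite /joins /etail /ehead /= => -[] [-> ->]; [left|right].
  by apply/mapP; exists k; rewrite ?mem_enum.
by apply/mapP; exists k; rewrite ?mem_enum ?addrK.
Qed.

Lemma big_neighbours (R : zmodType) x (f : vertex d -> R) :
  \sum_(y <- neighbours x) f y = \sum_k (f (x + evec k) + f (x - evec k)).
Proof. by rewrite big_cat !big_image /= -big_split. Qed.

End Geometry.

(** * Divergence in terms of edge values *)

Section Divergence.
Variables (R : realType) (d : nat).
Implicit Types (F : set (zedge d)) (theta : vertex d -> vertex d -> R).

Lemma divergence_neighbours F theta x : is_flow F theta ->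
  divergence F theta x = \sum_(y <- neighbours x) theta x y.
Proof.
move=> [_ th0]; rewrite /divergence (fsbig_seq _ _ (neighbours_uniq x)).
apply: fsbig_widen => [y [e _ je]|y [_ nadj]] /=; last exact: th0.
by apply/neighboursP; exists e.
Qed.

(** An antisymmetric function is determined by its values on the edges oriented
along the basis vectors; the divergence below is linear in finitely many of
those values and refers to no subgraph, which makes it stable under pointwise
limits and under changes of the subgraph. *)
Definition edge_divergence (f : zedge d -> R) (x : vertex d) : R :=
  \sum_k (f (x, k) - f (x - evec k, k)).

Definition edge_restr theta (e : zedge d) : R := theta (etail e) (ehead e).

Lemma divergenceE F theta x : is_flow F theta ->
  divergence F theta x = edge_divergence (edge_restr theta) x.
Proof.
move=> fth; rewrite (divergence_neighbours x fth) big_neighbours.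
apply: eq_bigr => k _; rewrite /edge_restr /etail /ehead /= subrK.
by rewrite [theta x (x - _)](fth.1 (x - evec k)).
Qed.

Lemma is_flow_out F theta e : is_flow F theta -> ~ F e -> edge_restr theta e = 0.
Proof. by move=> [_ th0] nFe; apply: th0 => /adj_edge. Qed.

End Divergence.

(** * Power means *)

Section Jensen.
Variable R : realType.

(** Convexity of the q-th power at the weights 1/(n+1) and n/(n+1): the step
which adds one term to a mean of n terms. *)
Lemma powR_mean_le (q x y : R) (n : nat) : 1 <= q -> 0 <= x -> 0 <= y ->
  n.+1%:R * ((x + n%:R * y) / n.+1%:R) `^ q <= x `^ q + n%:R * y `^ q.
Proof.
move=> q1 x0 y0.
have t0 : 0 <= (n.+1%:R : R)^-1 by rewrite invr_ge0.
have t1 : (n.+1%:R : R)^-1 <= 1 by rewrite invf_le1// ler1n.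
have n0 : n.+1%:R != 0 :> R by rewrite pnatr_eq0.
have := @convex_powR R q q1 (Itv01 t0 t1) x y.
rewrite !inE /= !in_itv /= !andbT => /(_ x0 y0).
rewrite [X in X `^ _ <= _]convRE [X in _ <= X]convRE /= /unstable.onem.
have -> : 1 - (n.+1%:R : R)^-1 = n%:R / n.+1%:R.
  by rewrite -natr1 in n0 *; field.
move=> h; rewrite mulrDl -(ler_pM2l (_ : 0 < (n.+1%:R : R)^-1)) ?invr_gt0//.
rewrite mulrA mulVf// mul1r.
have -> : x / n.+1%:R + n%:R * y / n.+1%:R = (n.+1%:R)^-1 * x + n%:R / n.+1%:R * y.
  by field.
by apply: (le_trans h); rewrite le_eqVlt; apply/orP; left; apply/eqP; field.
Qed.

(** Jensen's inequality for the uniform mean. Multiplying by the number of terms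
makes the empty sum a valid base case, the quotient by 0 being harmless. *)
Lemma powR_sum_mean (I : Type) (s : seq I) (f : I -> R) (q : R) :
  1 <= q -> (forall i, 0 <= f i) ->
  (size s)%:R * ((\sum_(i <- s) f i) / (size s)%:R) `^ q <=
    \sum_(i <- s) f i `^ q.
Proof.
move=> q1 f0; elim: s => [|i s IH]; first by rewrite !big_nil mul0r.
rewrite !big_cons /=; apply: le_trans (lerD (lexx _) IH).
have := powR_mean_le (size s) q1 (f0 i).
move=> /(_ ((\sum_(j <- s) f j) / (size s)%:R)).
have [s0|s0] := eqVneq (size s) 0%N.
  by move: s0 => /size0nil ->; rewrite !big_nil /= !mul0r; apply.
rewrite [_ * (_ / _)]mulrC divfK; last by rewrite pnatr_eq0.
by apply; rewrite divr_ge0// sumr_ge0.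
Qed.

Lemma powR_sum_le (I : Type) (s : seq I) (f : I -> R) (q : R) :
  1 <= q -> (forall i, 0 <= f i) ->
  (\sum_(i <- s) f i) `^ q <= (size s)%:R `^ (q - 1) * \sum_(i <- s) f i `^ q.
Proof.
move=> q1 f0; have q0 : 0 < q by apply: lt_le_trans q1.
have [/size0nil ->|s0] := eqVneq (size s) 0%N.
  by rewrite !big_nil powR0 ?gt_eqF// mulr0.
have n0 : (size s)%:R != 0 :> R by rewrite pnatr_eq0.
have := ler_wpM2l (powR_ge0 (size s)%:R (q - 1)) (powR_sum_mean s q1 f0).
apply: le_trans; rewrite mulrA [_ * (size s)%:R]mulrC mulr_powRB1//.
by rewrite -powRM// ?mulr_ge0 ?invr_ge0 ?sumr_ge0// [_ * (_ / _)]mulrC divfK.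
Qed.

End Jensen.

(** * Candidate routes and their edges *)

Section Routes.
Variable d : nat.
Implicit Types (x y u v : vertex d) (a e : zedge d) (i j k : 'I_d) (g : route d).

Definition sidestep j (b : bool) : vertex d := (-1) ^+ b *: evec j.

(** A candidate route of e is encoded by [None] for the direct edge and by
[Some (j, b)] for the bypass displaced by e_j or - e_j; codes form a finite
type, over which one can enumerate and count. *)
Definition route_code := option ('I_d * bool).

Definition valid_code e (c : route_code) : bool :=
  if c is Some (j, _) then j != e.2 else true.

Definition code_route e (c : route_code) : route d :=
  if c is Some (j, b) then
    [:: etail e; etail e + sidestep j b; ehead e + sidestep j b; ehead e]
  else direct_route e.

(** An edge is stored with its lower endpoint: the step from x to x - e_j is the
edge (x - e_j, j), whence the correction [- evec j *+ b], which is zero when b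
is false. *)
Definition code_edges e (c : route_code) : seq (zedge d) :=
  if c is Some (j, b) then
    [:: (etail e - evec j *+ b, j); (etail e + sidestep j b, e.2);
        (ehead e - evec j *+ b, j)]
  else [:: e].

Lemma candidateP e g :
  candidate e g <-> exists2 c, valid_code e c & g = code_route e c.
Proof.
split.
  case=> [->|[j [s [ji [] -> ->]]]]; first by exists None.
    by exists (Some (j, false)) => //; rewrite /= /sidestep expr0.
  by exists (Some (j, true)) => //; rewrite /= /sidestep expr1.
case=> -[[j b]|] /= ji ->; [right|by left].
exists j, ((-1) ^+ b); split=> //.
by case: b; [right; rewrite expr1|left; rewrite expr0].
Qed.

Lemma joins_side x j (b : bool) : joins (x - evec j *+ b, j) x (x + sidestep j b).
Proof.
rewrite /sidestep; case: b; rewrite ?expr1 ?expr0 ?scaleN1r ?scale1r ?subr0.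
  by right; rewrite /ehead /etail /= subrK.
by left.
Qed.

(** The edges are listed in the order of the steps; this correspondence gives
both directions of the translation from routes to lists of edges. *)
Lemma steps_code e c :
  all2 (fun (s : vertex d * vertex d) a => `[< joins a s.1 s.2 >])
       (steps (code_route e c)) (code_edges e c).
Proof.
case: c => [[j b]|] /=; rewrite ?andbT; last exact/asboolP/joins_etail_ehead.
apply/and3P; split; apply/asboolP; first exact: joins_side.
  by left; rewrite /etail /ehead /= addrAC.
exact/joins_sym/joins_side.
Qed.

Lemma belongs_code e c a : belongs a (code_route e c) <-> a \in code_edges e c.
Proof.
have := steps_code e c; rewrite /belongs.
elim: (steps _) (code_edges e c) => [|s ss IH] [|b bs] //=.
  by split=> // -[].
case/andP => /asboolP jb /IH{}IH; rewrite in_cons; split.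
  case=> t /[!inE] /orP[/eqP->|tss] ja; first by rewrite (joins_uniq ja jb) eqxx.
  by apply/orP; right; apply/IH; exists t.
case/orP=> [/eqP->|/IH[t tss jt]]; first by exists s => //; rewrite mem_head.
by exists t => //; rewrite in_cons tss orbT.
Qed.

Lemma step_joined e c s : s \in steps (code_route e c) ->
  exists2 a, a \in code_edges e c & joins a s.1 s.2.
Proof.
have := steps_code e c.
elim: (steps _) (code_edges e c) => [|t ss IH] [|b bs] //=.
case/andP => /asboolP jb /IH{}IH; rewrite in_cons => /orP[/eqP->|/IH[a abs ja]].
  by exists b => //; rewrite mem_head.
by exists a => //; rewrite in_cons abs orbT.
Qed.

Lemma size_code_edges e c : (size (code_edges e c) <= 3)%N.
Proof. by case: c => [[]|]. Qed.

Lemma evec_sidestep_neq0 i j b : j != i -> evec i + sidestep j b != 0.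
Proof.
move=> ji; apply/eqP => /(congr1 (fun M : 'rV[int]_d => M 0 i)).
by rewrite !mxE !eqxx eq_sym (negbTE ji) mulr0.
Qed.

Lemma sidestep_neq0 j b : sidestep j b != 0.
Proof.
apply/eqP => /(congr1 (fun M : 'rV[int]_d => M 0 j)).
by rewrite !mxE !eqxx; case: b.
Qed.

Lemma sidestep_inj j j' b b' : sidestep j b = sidestep j' b' -> (j, b) = (j', b').
Proof.
move=> /[dup] /(congr1 (fun M : 'rV[int]_d => M 0 j)).
rewrite !mxE !eqxx; case: eqP => [<-|_]; last by case: b; case: b'.
by case: b; case: b'.
Qed.

Lemma evec_neq0 i : evec i != 0.
Proof. by have := sidestep_neq0 i false; rewrite /sidestep expr0 scale1r. Qed.

Lemma steps_uniq e c : valid_code e c -> uniq (steps (code_route e c)).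
Proof.
case: c => [[j b]|] //= ji; rewrite !inE !andbT negb_or !xpair_eqE !negb_and.
have h1 : etail e != etail e + sidestep j b.
  by rewrite -subr_eq0 opprD addNKr oppr_eq0 sidestep_neq0.
have h2 : etail e + sidestep j b != ehead e + sidestep j b.
  rewrite -subr_eq0 /ehead opprD addrACA subrr addr0 opprD addNKr oppr_eq0.
  exact: evec_neq0.
have h3 : etail e != ehead e + sidestep j b.
  rewrite -subr_eq0 /ehead -addrA opprD addNKr oppr_eq0.
  exact: evec_sidestep_neq0.
by rewrite h1 h2 h3.
Qed.

Lemma code_edges_uniq e c : valid_code e c -> uniq (code_edges e c).
Proof.
case: c => [[j b]|] //= ji; rewrite !inE !andbT negb_or !xpair_eqE !negb_and.
rewrite ji /= [_.2 == j]eq_sym ji !orbT !andbT /= -subr_eq0.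
by rewrite opprD addrACA subrr addr0 /ehead opprD addNKr oppr_eq0 evec_neq0.
Qed.

(** The independence of the routes rests on this. Edges in direction e_i are
displaced by distinct vectors in distinct bypasses. An edge in direction e_j
fixes j, its position along e_i tells the first step of the bypass from the
last one, and its position along e_j gives the sign. *)
Lemma code_edges_disjoint e c c' a : valid_code e c -> valid_code e c' ->
  a \in code_edges e c -> a \in code_edges e c' -> c = c'.
Proof.
have sideD x j (b b' : bool) : x - evec j *+ b = x - evec j *+ b' -> b = b'.
  move=> /addrI/oppr_inj/eqP; have := evec_neq0 j.
  by case: b; case: b' => //= /negbTE; rewrite ?[0 == _]eq_sym => ->.
have farD x i j (b b' : bool) :
    j != i -> x - evec j *+ b <> x + evec i - evec j *+ b'.
  move=> ji /(congr1 (fun M : 'rV[int]_d => M 0 i)).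
  by case: b; case: b'; rewrite /= ?mulr1n ?mulr0n !mxE ?eqxx ?[i == j]eq_sym;
    rewrite ?(negbTE ji) /=; lia.
have directD x i j b : j != i -> (x, i) \notin code_edges (x, i) (Some (j, b)).
  move=> ji; rewrite !inE !xpair_eqE [i == j]eq_sym (negbTE ji) !andbF orbF /=.
  by rewrite ?eqxx ?andbT -subr_eq0 opprD addNKr oppr_eq0 sidestep_neq0.
case: e => x i.
case: c => [[j b]|]; case: c' => [[j' b']|] // ji ji'; rewrite /= in ji ji'.
- rewrite !inE => /or3P[]/eqP-> /or3P[]/eqP[].
  + by move=> + jj; rewrite -jj => /sideD ->.
  + by move=> _ jj; rewrite jj eqxx in ji.
  + by move=> + jj; rewrite -jj => /(farD _ _ _ _ _ ji).
  + by move=> _ jj; rewrite -jj eqxx in ji'.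
  + by move=> /addrI/sidestep_inj ->.
  + by move=> _ jj; rewrite -jj eqxx in ji'.
  + by move=> + jj; rewrite -jj => /esym/(farD _ _ _ _ _ ji).
  + by move=> _ jj; rewrite jj eqxx in ji.
  + by move=> + jj; rewrite -jj => /sideD ->.
- move=> + /[!inE] /eqP ae; rewrite ae => h.
  by have := directD x i j b ji; rewrite h.
- by rewrite inE => /eqP-> h; have := directD x i j' b' ji'; rewrite h.
Qed.

(** Besides a itself, a demand edge can use a as the first, the middle or the
last edge of a bypass; solving for the demand edge in each case gives the three
entries. In the first and last case c is the direction of the demand edge and
the sign of the displacement, in the middle case the displacement. *)
Definition near_edges a : seq (zedge d) :=
  a :: flatten [seq [:: (a.1 + evec a.2 *+ c.2, c.1);
                        (a.1 - sidestep c.1 c.2, a.2);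
                        (a.1 + evec a.2 *+ c.2 - evec c.1, c.1)]
               | c : 'I_d * bool].

Lemma size_near_edges a : size (near_edges a) = (1 + 3 * (d * 2))%N.
Proof.
rewrite /= size_flatten /shape -map_comp sumnE big_map big_enum /=.
by rewrite sum_nat_const card_prod card_ord card_bool mulnC.
Qed.

Lemma mem_near_edges e c a : a \in code_edges e c -> e \in near_edges a.
Proof.
case: c => [[j b]|] /= /[!inE]; last by move/eqP->; rewrite eqxx.
move=> ha; apply/orP; right; apply/flattenP.
case: e ha => x i.
case/or3P=> /eqP-> /=.
- exists [:: (x - evec j *+ b + evec j *+ b, i);
        (x - evec j *+ b - sidestep i b, j);
        (x - evec j *+ b + evec j *+ b - evec i, i)].
    by apply/mapP; exists (i, b); rewrite ?mem_enum.
  by rewrite subrK mem_head.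
- exists [:: (x + sidestep j b + evec i *+ b, j);
        (x + sidestep j b - sidestep j b, i);
        (x + sidestep j b + evec i *+ b - evec j, j)].
    by apply/mapP; exists (j, b); rewrite ?mem_enum.
  by rewrite addrK !inE eqxx orbT.
exists [:: (ehead (x, i) - evec j *+ b + evec j *+ b, i);
        (ehead (x, i) - evec j *+ b - sidestep i b, j);
        (ehead (x, i) - evec j *+ b + evec j *+ b - evec i, i)].
  by apply/mapP; exists (i, b); rewrite ?mem_enum.
by rewrite subrK /ehead addrK !inE eqxx !orbT.
Qed.

End Routes.

(** * Unit path flows *)

Section BigDelta.
Variable R : pzRingType.

Lemma big_delta (T : eqType) (s : seq T) (z : T) (f : T -> R) :
  uniq s -> z \in s -> \sum_(e <- s) f e * (e == z)%:R = f z.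
Proof.
move=> us zs; rewrite (bigD1_seq z)//= eqxx mulr1 big1 ?addr0// => e /negbTE->.
by rewrite mulr0.
Qed.

Lemma mem_uniq_sum (T : eqType) (s : seq T) (z : T) :
  uniq s -> (z \in s)%:R = \sum_(t <- s) (t == z)%:R :> R.
Proof.
move=> us; case: (boolP (z \in s)) => zs.
  by under eq_bigr do rewrite -[_%:R]mul1r; rewrite big_delta.
rewrite big_seq big1// => t ts; case: eqP => // tz.
by rewrite -tz ts in zs.
Qed.

End BigDelta.

Section PathFlow.
Variables (R : realType) (d : nat).
Implicit Types (x y u v : vertex d) (a e : zedge d) (g : route d).

Lemma path_flowN g u v : path_flow R g v u = - path_flow R g u v.
Proof. by rewrite /path_flow opprB. Qed.

Lemma path_flow_le1 g u v : `|path_flow R g u v| <= 1.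
Proof.
rewrite /path_flow; case: (_ \in _); case: (_ \in _);
  by rewrite ?subrr ?subr0 ?sub0r ?normrN ?normr0 ?normr1.
Qed.

Lemma path_flow_eq0 g a u v : joins a u v -> ~ belongs a g ->
  path_flow R g u v = 0.
Proof.
move=> jo nb; rewrite /path_flow.
case: (boolP (_ \in _)) => [h|_]; first by case: nb; exists (u, v).
case: (boolP (_ \in _)) => [h|_]; last by rewrite subrr.
by case: nb; exists (v, u) => //; apply: joins_sym.
Qed.

Lemma path_flow_joined e g u v : candidate e g -> path_flow R g u v != 0 ->
  exists2 a, belongs a g & joins a u v.
Proof.
move=> /candidateP[c _ ->]; rewrite /path_flow.
have [h _|_] := boolP ((u, v) \in _).
  by have [a ? ?] := step_joined h; exists a => //; exists (u, v).
have [h _|_] := boolP ((v, u) \in _); last by rewrite subrr eqxx.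
have [a ? ?] := step_joined h; exists a; first by exists (v, u).
exact: joins_sym.
Qed.

Lemma steps_telescope x y g :
  \sum_(s <- steps (y :: g)) ((s.1 == x)%:R - (s.2 == x)%:R) =
  (y == x)%:R - (last y g == x)%:R :> R.
Proof.
elim: g y => [|z g IH] y; first by rewrite /steps /= big_nil subrr.
rewrite [steps _](_ : _ = (y, z) :: steps (z :: g))//.
by rewrite big_cons IH /= addrA subrK.
Qed.

(** The steps of a candidate route are pairwise distinct, so membership of a
step equals its multiplicity and the sum over neighbours telescopes along the
route. *)
Lemma path_flow_divergence e g x : candidate e g ->
  \sum_(y <- neighbours x) path_flow R g x y =
  (etail e == x)%:R - (ehead e == x)%:R.
Proof.
move=> /candidateP[c okc ->].
have us := steps_uniq okc.
have step_nb s : s \in steps (code_route e c) ->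
    (s.1 == x -> s.2 \in neighbours x) /\ (s.2 == x -> s.1 \in neighbours x).
  move=> /step_joined[a _ ja]; split=> /eqP <-; apply/neighboursP; exists a => //.
  exact: joins_sym.
transitivity (\sum_(s <- steps (code_route e c))
    ((s.1 == x)%:R - (s.2 == x)%:R) : R); last first.
  by case: c {okc us step_nb} => [[j b]|]; rewrite steps_telescope.
under eq_bigr do rewrite /path_flow !(mem_uniq_sum _ _ us).
rewrite sumrB [X in X - _]exchange_big [X in _ - X]exchange_big /= -sumrB.
rewrite big_seq [RHS]big_seq; apply: eq_bigr => -[u v] /step_nb[/= nu nv].
have hu : \sum_(y <- neighbours x) ((u, v) == (x, y))%:R = (u == x)%:R :> R.
  case: eqP nu => [->|ux] nu.
    under eq_bigr => y _ do rewrite xpair_eqE eqxx /= eq_sym.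
    by rewrite -mem_uniq_sum ?neighbours_uniq// nu.
  by rewrite big1// => y _; rewrite xpair_eqE; case: eqP ux.
have hv : \sum_(y <- neighbours x) ((u, v) == (y, x))%:R = (v == x)%:R :> R.
  case: eqP nv => [->|vx] nv.
    under eq_bigr => y _ do rewrite xpair_eqE eqxx andbT eq_sym.
    by rewrite -mem_uniq_sum ?neighbours_uniq// nv.
  by rewrite big1// => y _; rewrite xpair_eqE andbC; case: eqP vx.
by rewrite hu hv.
Qed.

(** The dual computation: summing over edges the divergence of the unit flow on
each single edge. Any list containing all edges at x will do, since the others
contribute zero. *)
Lemma edge_divergence_sum (S : seq (zedge d)) (f : zedge d -> R) x :
  uniq S -> (forall k, (x, k) \in S /\ (x - evec k, k) \in S) ->
  \sum_(e <- S) f e * ((etail e == x)%:R - (ehead e == x)%:R) =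
  edge_divergence f x.
Proof.
move=> uS inS; rewrite /edge_divergence.
under [RHS]eq_bigr => k _.
  rewrite -(big_delta f uS (inS k).1) -(big_delta f uS (inS k).2) -sumrB.
  over.
rewrite /= exchange_big /=; apply: eq_bigr => -[y i] _ /=.
rewrite sumrB -!mulr_sumr -mulrBr; congr (_ * (_ - _)).
  rewrite (bigD1 i)//= big1 ?addr0 => [|k /negbTE ki]; rewrite xpair_eqE.
    by rewrite eqxx andbT.
  by rewrite [i == k]eq_sym ki andbF.
rewrite (bigD1 i)//= big1 ?addr0 => [|k /negbTE ki]; rewrite xpair_eqE.
  by rewrite eqxx andbT /ehead /= [y == _]eq_sym subr_eq eq_sym.
by rewrite [i == k]eq_sym ki andbF.
Qed.

End PathFlow.

(** * Congestion of a physical edge *)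

Section Kd.
Variables (R : realType) (d : nat).

Definition demand (a : zedge d) : set (zedge d) :=
  [set e | exists2 g, candidate e g & belongs a g].

Lemma demand_near a : demand a `<=` [set` near_edges a].
Proof.
move=> e [_ /candidateP[c _ ->]] /belongs_code; exact: mem_near_edges.
Qed.

Lemma finite_demand a : finite_set (demand a).
Proof. exact: sub_finite_set (@demand_near a) (finite_seq _). Qed.

Lemma counting_demand_le a :
  (@counting _ R (demand a) <= (1 + 3 * (d * 2))%:R%:E)%E.
Proof.
rewrite /counting asboolT ?lee_fin ?ler_nat; last exact: finite_demand.
rewrite -(size_near_edges a); apply: uniq_leq_size; first exact: fset_uniq.
by move=> e; rewrite in_fset_set ?inE => [/demand_near//|]; exact: finite_demand.
Qed.

(** [Kd] is obtained by [fine], which would be 0 on an infinite supremum; the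
uniform bound on the number of demand edges rules this out. *)
Lemma size_le_Kd a (s : seq (zedge d)) : uniq s -> [set` s] `<=` demand a ->
  (size s)%:R <= Kd R d.
Proof.
move=> us sd.
have ub : (ereal_sup (range (fun b => @counting _ R (demand b))) <=
    (1 + 3 * (d * 2))%:R%:E)%E.
  by apply: ge_ereal_sup => _ [b _ <-]; exact: counting_demand_le.
have lb : ((size s)%:R%:E <=
    ereal_sup (range (fun b => @counting _ R (demand b))))%E.
  apply: (@le_trans _ _ (@counting _ R (demand a))); last first.
    by apply: ereal_sup_ubound; exists a.
  rewrite /counting asboolT ?lee_fin ?ler_nat; last exact: finite_demand.
  apply: uniq_leq_size => // e es.
  by rewrite in_fset_set ?inE; [exact: sd|exact: finite_demand].
have fin : ereal_sup (range (fun b => @counting _ R (demand b))) \is a fin_num.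
  rewrite fin_numElt (lt_le_trans _ lb) ?ltNyr//.
  by rewrite (le_lt_trans ub)// ltry.
by rewrite -lee_fin /Kd fineK.
Qed.

Lemma Kd_ge0 (a : zedge d) : 0 <= Kd R d.
Proof. by apply: (@size_le_Kd a [::]). Qed.

End Kd.

(** * The lifted flow *)

Section Lift.
Variables (R : realType) (d : nat) (F : set (zedge d)).
Variables (theta : vertex d -> vertex d -> R) (gamma : zedge d -> route d).
Hypothesis theta_flow : is_flow F theta.
Hypothesis gamma_candidate : forall e, F e -> candidate e (gamma e).
Implicit Types (x y u v : vertex d) (a e : zedge d).

Local Notation f := (edge_restr theta).
Local Notation Theta := (lift_flow F gamma theta).

(** The finitely supported sum defining the lift as a big sum over any list that
contains its support; edges of the list outside F contribute zero because theta
vanishes there. *)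
Lemma lift_flowE (S : seq (zedge d)) u v : uniq S ->
  (forall e, F e -> path_flow R (gamma e) u v != 0 -> e \in S) ->
  Theta u v = \sum_(e <- S) f e * path_flow R (gamma e) u v.
Proof.
move=> uS hS; rewrite /lift_flow (fsbig_seq _ _ uS).
have f0 e : ~ F e -> f e * path_flow R (gamma e) u v = 0.
  by move=> nF; rewrite (is_flow_out theta_flow nF) mul0r.
transitivity (\sum_(e \in setT) f e * path_flow R (gamma e) u v).
  by apply: fsbig_widen => // e [_ /=]; exact: f0.
apply/esym/fsbig_widen => // e [_ /=] neS.
have [Fe|/f0//] := pselect (F e).
have [->|/(hS _ Fe) eS] := eqVneq (path_flow R (gamma e) u v) 0.
  by rewrite mulr0.
by case: neS.
Qed.

(** One list that works for all edges at x simultaneously, as needed to exchange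
the sum over demand edges with the sum over neighbours of x. *)
Definition near_vertex x : seq (zedge d) :=
  undup (flatten [seq near_edges (x, k) ++ near_edges (x - evec k, k)
                 | k : 'I_d]).

Lemma mem_near_vertex x y a e : joins a x y -> e \in near_edges a ->
  e \in near_vertex x.
Proof.
case: a => z k ja ea; rewrite mem_undup; apply/flattenP.
exists (near_edges (x, k) ++ near_edges (x - evec k, k)).
  by apply/mapP; exists k; rewrite ?mem_enum.
rewrite mem_cat; case: ja; rewrite /etail /ehead /= => -[xz _].
  by rewrite xz ea.
by rewrite [in X in _ || X]xz addrK ea orbT.
Qed.

Lemma lift_flow_near x y :
  Theta x y = \sum_(e <- near_vertex x) f e * path_flow R (gamma e) x y.
Proof.
apply: lift_flowE => [|e Fe]; first exact: undup_uniq.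
move/(path_flow_joined (gamma_candidate Fe)) => [a ba ja].
apply: (mem_near_vertex ja); apply: demand_near; exists (gamma e) => //.
exact: gamma_candidate.
Qed.

Lemma lift_is_flow (G : set (zedge d)) :
  (forall e, F e -> route_open G (gamma e)) -> is_flow G Theta.
Proof.
move=> gG; split=> [x y|x y nadj].
  rewrite /lift_flow -mulN1r mulr_fsumr; apply: eq_fsbigr => e _.
  by rewrite path_flowN mulrN mulN1r.
rewrite lift_flow_near big1// => e _.
have [Fe|nFe] := pselect (F e); last by rewrite (is_flow_out theta_flow nFe) mul0r.
have [->|] := eqVneq (path_flow R (gamma e) x y) 0; first by rewrite mulr0.
move/(path_flow_joined (gamma_candidate Fe)) => [a ba ja].
by case: nadj; exists a => //; apply: gG ba.
Qed.

(** Route by route: the path flow of a route and the unit flow on its demand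
edge both have divergence 1 at the tail, -1 at the head and 0 elsewhere. *)
Lemma lift_divergence (G : set (zedge d)) x :
  (forall e, F e -> route_open G (gamma e)) ->
  divergence G Theta x = divergence F theta x.
Proof.
move=> gG; rewrite (divergence_neighbours _ (lift_is_flow gG)).
rewrite (divergenceE _ theta_flow) -(@edge_divergence_sum _ _ (near_vertex x)).
- under eq_bigr do rewrite lift_flow_near.
  rewrite exchange_big /=; apply: eq_bigr => e _; rewrite -mulr_sumr.
  have [Fe|nFe] := pselect (F e); last by rewrite (is_flow_out theta_flow nFe) !mul0r.
  by rewrite (path_flow_divergence _ _ (gamma_candidate Fe)).
- exact: undup_uniq.
move=> k; split.
  apply: (@mem_near_vertex x (x + evec k) (x, k)); first by left.
  by rewrite mem_head.
apply: (@mem_near_vertex x (x - evec k) (x - evec k, k)); last by rewrite mem_head.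
by right; rewrite /ehead /= subrK.
Qed.

Lemma lift_unit_flow (G : set (zedge d)) o :
  (forall e, F e -> route_open G (gamma e)) ->
  unit_flow F o theta -> unit_flow G o Theta.
Proof.
move=> gG [_ do1 dx0]; split; first exact: lift_is_flow.
  by rewrite lift_divergence.
by move=> x xo; rewrite lift_divergence// dx0.
Qed.

Local Notation used := (fun a e => `[< F e /\ belongs a (gamma e) >]).

(** At most [Kd] demand edges contribute to the value of the lift at a, each
with a coefficient of absolute value at most 1, so the bound is Jensen's
inequality. One list U can serve all the physical edges over which one sums
next. *)
Lemma lift_powR_le (q : R) a (U : seq (zedge d)) : 1 <= q ->
  uniq U -> {subset near_edges a <= U} ->
  `|edge_restr Theta a| `^ q <=
  Kd R d `^ (q - 1) * \sum_(e <- U) `|f e| `^ q * (used a e)%:R.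
Proof.
move=> q1 uU sU.
pose S := [seq e <- U | used a e].
have uS : uniq S by rewrite filter_uniq.
have -> : edge_restr Theta a =
    \sum_(e <- S) f e * path_flow R (gamma e) (etail a) (ehead a).
  apply: lift_flowE => // e Fe nz; rewrite mem_filter.
  have [ba|nba] := pselect (belongs a (gamma e)); last first.
    by rewrite (path_flow_eq0 _ (joins_etail_ehead a) nba) eqxx in nz.
  rewrite asboolT//=; apply: sU; apply: demand_near; exists (gamma e) => //.
  exact: gamma_candidate.
have q0 : 0 <= q by apply: le_trans q1.
apply: (@le_trans _ _ ((\sum_(e <- S) `|f e|) `^ q)).
  apply: ge0_ler_powR; rewrite ?nnegrE ?sumr_ge0//.
  apply: (le_trans (ler_norm_sum _ _ _)); apply: ler_sum => e _.
  by rewrite normrM ler_piMr// path_flow_le1.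
apply: (le_trans (powR_sum_le _ q1 _)) => //.
have -> : \sum_(e <- U) `|f e| `^ q * (used a e)%:R = \sum_(e <- S) `|f e| `^ q.
  rewrite big_filter [RHS]big_mkcond /=; apply: eq_bigr => e _.
  by case: ifP => _; rewrite ?mulr1 ?mulr0.
apply: ler_wpM2r; first by rewrite sumr_ge0// => e _; exact: powR_ge0.
apply: ge0_ler_powR; rewrite ?nnegrE ?subr_ge0 ?(Kd_ge0 _ a)//.
apply: (@size_le_Kd _ _ a) => // e; rewrite /= mem_filter => /andP[/asboolP[Fe ba] _].
by exists (gamma e) => //; exact: gamma_candidate.
Qed.

(** After exchanging the two sums in the previous bound, the term of a demand
edge is counted once for each edge of its route, hence at most three times. *)
Lemma lift_energy (q : R) : 1 <= q ->
  (energy q setT Theta <= (3 * Kd R d `^ (q - 1))%:E * energy q F theta)%E.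
Proof.
move=> q1; apply: ge_ereal_sup => _ [A [finA _] <-].
rewrite -(fset_setK finA); set As := fset_set A.
rewrite -(fsbig_seq _ _ (fset_uniq As)) sumEFin.
pose U := [seq e <- undup (flatten [seq near_edges a | a <- As]) | `[< F e >]].
have uU : uniq U by rewrite filter_uniq// undup_uniq.
pose U' := undup (flatten [seq near_edges a | a <- As]).
have FU e : e \in U -> F e by rewrite mem_filter => /andP[/asboolP].
have C0 : 0 <= Kd R d `^ (q - 1) by exact: powR_ge0.
apply: (@le_trans _ _ ((3 * Kd R d `^ (q - 1)) * \sum_(e <- U) `|f e| `^ q)%:E).
  rewrite lee_fin [3 * _]mulrC -mulrA.
  apply: (@le_trans _ _ (\sum_(a <- As) Kd R d `^ (q - 1) *
      \sum_(e <- U') `|f e| `^ q * (used a e)%:R)).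
    rewrite big_seq [leRHS]big_seq; apply: ler_sum => a aA.
    apply: lift_powR_le => //; first exact: undup_uniq.
    move=> e ea; rewrite mem_undup; apply/flattenP; exists (near_edges a) => //.
    by apply/mapP; exists a.
  rewrite -mulr_sumr ler_wpM2l// exchange_big mulr_sumr /=.
  rewrite [leRHS]big_filter [leRHS]big_mkcond /=; apply: ler_sum => e _.
  rewrite -mulr_sumr; case: asboolP => Fe; last first.
    by rewrite big1 ?mulr0// => a _; rewrite asboolF// => -[].
  rewrite [leRHS]mulrC ler_wpM2l ?powR_ge0//.
  have [c okc gc] := (candidateP _ _).1 (gamma_candidate Fe).
  have -> : \sum_(a <- As) (used a e)%:R = (size [seq a <- As | used a e])%:R :> R.
    by rewrite size_filter -sum1_count natr_sum [RHS]big_mkcond /=;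
      apply: eq_bigr => a _; case: asboolP.
  rewrite ler_nat; apply: leq_trans (size_code_edges e c).
  apply: uniq_leq_size; first by rewrite filter_uniq// fset_uniq.
  by move=> a; rewrite mem_filter gc => /andP[/asboolP[_ /belongs_code]].
rewrite EFinM; apply: lee_wpmul2l; first by rewrite lee_fin mulr_ge0.
rewrite -sumEFin /energy; apply: esum_ge; exists [set` U].
  by split; [exact: finite_seq|move=> e /=; exact: FU].
by rewrite -fsbig_seq.
Qed.

End Lift.

(** * Limits along ultrafilters *)

Section UltraLimit.
Variable R : realType.

Lemma ultra_image_filter (T U : Type) (h : T -> U) (F : set_system T) :
  UltraFilter F -> UltraFilter (h @ F).
Proof.
move=> FU; split=> [|G PG sFG]; first exact: fmap_proper_filter.
apply/seteqP; split; last exact: sFG.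
move=> A GA; have [//|nFA] := in_ultra_setVsetC (h @^-1` A) FU.
have GC : G (~` A) by apply: sFG.
have : G (A `&` ~` A) by apply: filterI.
by rewrite setICr => /filter_not_empty.
Qed.

(** Along one ultrafilter all bounded functions converge simultaneously, which
replaces a diagonal extraction over the countably many edges. *)
Lemma ultra_bounded_cvg (T : Type) (F : set_system T) (h : T -> R) (B : R) :
  UltraFilter F -> (forall t, `|h t| <= B) -> exists l : R, h @ F --> l.
Proof.
move=> FU hB; have := @segment_compact R (- B) B; rewrite compact_ultra.
move=> /(_ _ (ultra_image_filter h FU)) [].
  suff : F (h @^-1` `[- B, B]) by [].
  by apply: filterE => t; rewrite /= in_itv /= -ler_norml.
by move=> l [_ hl]; exists l.
Qed.

Lemma cvg_sumr (T I : Type) (F : set_system T) (r : seq I)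
    (h : I -> T -> R) (l : I -> R) : Filter F ->
  (forall i, h i @ F --> l i) ->
  (fun t => \sum_(i <- r) h i t) @ F --> \sum_(i <- r) l i.
Proof.
move=> FF hl; elim: r => [|i r IH].
  by rewrite big_nil; under eq_cvg do rewrite big_nil; exact: cvg_cst.
rewrite big_cons; under eq_cvg do rewrite big_cons.
exact: cvgD.
Qed.

Lemma continuous_powR (q : R) : 0 < q -> continuous (fun x : R => `|x| `^ q).
Proof.
move=> q0 x; have [->|x0] := eqVneq x 0.
  rewrite /continuous_at normr0 powR0 ?gt_eqF//.
  apply/cvgrPdist_le => e e0.
  have e1 : 0 < e `^ q^-1 by exact: powR_gt0.
  exists (e `^ q^-1) => //= y /=; rewrite !sub0r !normrN => ye.
  rewrite ger0_norm ?powR_ge0//.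
  have -> : e = (e `^ q^-1) `^ q.
    by rewrite -powRrM mulVf ?gt_eqF// powRr1// ltW.
  by apply: ge0_ler_powR; rewrite ?nnegrE ?powR_ge0// ltW.
apply: (@continuous_comp _ _ _ (fun y : R => `|y|) (fun y : R => y `^ q)).
  exact: norm_continuous.
apply: differentiable_continuous; apply/derivable1_diffP.
by apply: derivable_powR; rewrite in_itv /= andbT normr_gt0.
Qed.

End UltraLimit.

(** * Unit flows of bounded energy *)

Section BoundedFlow.
Variables (R : realType) (d : nat).
Implicit Types (F : set (zedge d)) (f : zedge d -> R).

(** Every condition involves finitely many edges at a time and is closed, which
is what a pointwise limit preserves. *)
Definition bounded_flow (q : R) (o : vertex d) (M : R) F f : Prop :=
  [/\ forall e, ~ F e -> f e = 0,
      forall x, edge_divergence f x = (x == o)%:R &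
      forall s : seq (zedge d), uniq s -> \sum_(e <- s) `|f e| `^ q <= M].

Lemma bounded_flow_mono q o M F F' f : F `<=` F' ->
  bounded_flow q o M F f -> bounded_flow q o M F' f.
Proof. by move=> FF' [f0 df ef]; split=> // e nF'; apply: f0 => /FF'. Qed.

(** The antisymmetric extension of a function on edges. *)
Definition flow_of_edges f (u v : vertex d) : R :=
  \sum_k ((v == u + evec k)%:R * f (u, k) - (u == v + evec k)%:R * f (v, k)).

Lemma edge_restr_flow f e : edge_restr (flow_of_edges f) e = f e.
Proof.
case: e => x i; rewrite /edge_restr /flow_of_edges /etail /ehead /=.
have h k : (x == x + evec i + evec k) = false.
  apply/negbTE; rewrite -subr_eq0 -addrA opprD addNKr oppr_eq0; exact: evecD_neq0.
under eq_bigr do rewrite h mul0r subr0 (inj_eq (addrI x)) (inj_eq (@evec_inj d)).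
rewrite (bigD1 i)//= eqxx mul1r big1 ?addr0// => k ki.
by rewrite eq_sym (negbTE ki) mul0r.
Qed.

Lemma flow_of_edges_is_flow F f : (forall e, ~ F e -> f e = 0) ->
  is_flow F (flow_of_edges f).
Proof.
move=> f0; split=> [x y|x y nadj]; rewrite /flow_of_edges.
  by rewrite -sumrN; apply: eq_bigr => k _; rewrite opprB.
apply: big1 => k _; case: eqP => [yx|_]; last first.
  rewrite mul0r sub0r; case: eqP => [xy|_]; last by rewrite mul0r oppr0.
  rewrite mul1r f0 ?oppr0// => Fe; case: nadj; exists (y, k) => //.
  by right.
rewrite mul1r f0; last by move=> Fe; case: nadj; exists (x, k) => //; left.
rewrite sub0r; case: eqP => [xy|_]; last by rewrite mul0r oppr0.
rewrite mul1r f0 ?oppr0// => Fe; case: nadj; exists (y, k) => //.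
by right.
Qed.

Lemma carries_flowP (q : R) o F : 0 < q ->
  carries_flow q o F <-> exists (n : nat) f, bounded_flow q o n%:R F f.
Proof.
move=> q0; split.
  case=> theta [[fl do1 dx0] fin].
  have e0 : (0 <= energy q F theta)%E.
    by apply: esum_ge0 => e _; rewrite lee_fin powR_ge0.
  have [n hn] : exists n : nat, (energy q F theta <= n%:R%:E)%E.
    have efin : energy q F theta \is a fin_num by rewrite ge0_fin_numE.
    rewrite -(fineK efin); exists (Num.bound (fine (energy q F theta))).
    by rewrite lee_fin ltW// archi_boundP// fine_ge0.
  exists n, (edge_restr theta); split.
  - by move=> e; exact: is_flow_out.
  - move=> x; rewrite -(divergenceE _ fl); case: eqP => [->//|/eqP xo].
    exact: dx0.
  move=> s us; rewrite -lee_fin; apply: le_trans hn.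
  apply: esum_ge; exists [set` [seq e <- s | `[< F e >]]].
    by split=> [|e /=]; [exact: finite_seq|rewrite mem_filter => /andP[/asboolP]].
  rewrite -fsbig_seq ?filter_uniq// sumEFin lee_fin big_filter.
  rewrite [leRHS]big_mkcond /=; apply: ler_sum => e _; case: asboolP => // nF.
  by rewrite (is_flow_out fl nF) normr0 powR0// gt_eqF.
case=> n [f [f0 df ef]]; exists (flow_of_edges f).
have fl := flow_of_edges_is_flow f0.
have eE : edge_restr (flow_of_edges f) = f by apply/funext => e; exact: edge_restr_flow.
split.
  split=> //; first by rewrite (divergenceE _ fl) eE df eqxx.
  by move=> x /negbTE xo; rewrite (divergenceE _ fl) eE df xo.
apply: (@le_lt_trans _ _ n%:R%:E); last exact: ltry.
apply: ge_ereal_sup => _ [A [finA _] <-].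
rewrite -(fset_setK finA) -(fsbig_seq _ _ (fset_uniq _)) sumEFin lee_fin.
apply: le_trans (ef _ (fset_uniq (fset_set A))).
by apply: ler_sum => e _; rewrite -[in X in _ <= X]eE.
Qed.

Lemma carries_flow_mono (q : R) o F F' : 0 < q -> F `<=` F' ->
  carries_flow q o F -> carries_flow q o F'.
Proof.
move=> q0 FF' /carries_flowP-/(_ q0)[n [f hf]].
by apply/carries_flowP => //; exists n, f; exact: bounded_flow_mono hf.
Qed.

(** Compactness: the energy bound M confines the value at each edge to
[- M^(1/q), M^(1/q)], so the flows converge along an ultrafilter. A closed edge
e is among the first n edges as soon as n exceeds its number, hence the limit
vanishes at e; the divergences and the partial energy sums are continuous. *)
Lemma bounded_flow_limit (q : R) o M F : 0 < q ->
  (forall n : nat, exists f,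
    bounded_flow q o M (F `|` [set e : zedge d | (n <= choice.pickle e)%N]) f) ->
  exists f, bounded_flow q o M F f.
Proof.
move=> q0 /choice[f hf].
have [U [UU sU]] := @ultraFilterLemma _ (\oo : set_system nat) _.
have fB e n : `|f n e| <= M `^ q^-1.
  have [_ _ /(_ [:: e] isT)] := hf n; rewrite big_seq1 => h.
  have -> : `|f n e| = (`|f n e| `^ q) `^ q^-1.
    by rewrite -powRrM divff ?gt_eqF// powRr1.
  apply: ge0_ler_powR; rewrite ?nnegrE ?invr_ge0 ?powR_ge0//; first exact: ltW.
  exact: le_trans (powR_ge0 _ _) h.
have /choice[g gl] : forall e, exists l : R, f ^~ e @ U --> l.
  by move=> e; apply: ultra_bounded_cvg (fB e).
exists g; split.
- move=> e nFe; apply: (cvg_unique (@Rhausdorff R) (gl e)).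
  apply: cvg_near_cst; apply: sU; exists (choice.pickle e).+1 => // n /= en.
  have [f0 _ _] := hf n; apply: f0 => -[//|].
  by rewrite /= leqNgt en.
- move=> x; apply: (@cvg_unique _ (@Rhausdorff R)
    ((fun n => edge_divergence (f n) x) @ U)).
    rewrite /edge_divergence; apply: cvg_sumr => k.
    by apply: cvgB; exact: gl.
  apply: cvg_near_cst; apply: filterE => n; by have [_ -> _] := hf n.
move=> s us.
apply: (@cvgr_to_le _ U _ _ (fun n => \sum_(e <- s) `|f n e| `^ q)).
  apply: cvg_sumr => e.
  apply: (@cvg_comp _ _ _ (fun n => f n e) (fun x : R => `|x| `^ q) _ _ _ (gl e)).
  exact: continuous_powR.
by apply: filterE => n; have [_ _] := hf n; apply.
Qed.

End BoundedFlow.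

(** * Measurability of carrying a flow *)

Section ConfigEvent.
Variable d : nat.

Let cylinders : set (set (zedge d -> bool)) :=
  [set [set c : zedge d -> bool | c e] | e in [set: zedge d]].

Lemma config_event_cylinder (s : seq (zedge d)) (A : set (zedge d -> bool)) :
  (forall c c', {in s, c =1 c'} -> A c -> A c') -> config_event A.
Proof.
elim: s A => [|e s IH] A detA.
  have [[c Ac]|nA] := pselect (exists c, A c).
    have -> : A = setT by apply/seteqP; split=> // c' _; exact: detA Ac.
    exact: (@measurableT _ (g_sigma_algebraType cylinders)).
  have -> : A = set0 by apply/seteqP; split=> // c Ac; case: nA; exists c.
  exact: (@measurable0 _ (g_sigma_algebraType cylinders)).
(* Splitting according to the state of e leaves two events determined by s. *)
pose upd b (c : zedge d -> bool) e' := if e' == e then b else c e'.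
have mA b : config_event [set c | A (upd b c)].
  apply: IH => c c' cc'; apply: detA => e'; rewrite /upd inE.
  by case: eqP => //= _ /cc'.
have me : config_event [set c : zedge d -> bool | c e].
  by rewrite /config_event; apply: sub_sigma_algebra; exists e.
have updE c : upd (c e) c = c by apply/funext => e'; rewrite /upd; case: eqP => [->|].
have -> : A = ([set c | A (upd true c)] `&` [set c | c e]) `|`
              ([set c | A (upd false c)] `&` ~` [set c | c e]).
  apply/seteqP; split=> c /=; have := updE c.
    by case: (c e) => E Ac; [left|right]; rewrite E.
  by case: (c e) => E [[]|[]]; rewrite ?E //.
have mI (B C : set (zedge d -> bool)) :
    config_event B -> config_event C -> config_event (B `&` C).
  exact: (@measurableI _ (g_sigma_algebraType cylinders)).
apply: (@measurableU _ (g_sigma_algebraType cylinders)); apply: mI => //.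
exact: (@measurableC _ (g_sigma_algebraType cylinders)).
Qed.

Lemma measurable_field_event (dT : measure_display) (T : measurableType dT)
    (Y : zedge d -> T -> bool) A :
  measurable_field Y -> config_event A ->
  measurable [set w | A (fun e => Y e w)].
Proof.
move=> mY; pose G := [set B | measurable [set w | B (fun e => Y e w)]].
suff : @config_event d `<=` G by apply.
apply: smallest_sub; first split.
- exact: measurable0.
- by move=> B mB; rewrite setTD; exact: measurableC.
- by move=> B mB; exact: bigcupT_measurable.
move=> _ [e _ <-]; have := mY e measurableT [set true] I.
by rewrite setTI.
Qed.

Lemma config_event_carries_flow (R : realType) (q : R) (o : vertex d) : 0 < q ->
  config_event [set c : zedge d -> bool | carries_flow q o [set e | c e]].
Proof.
move=> q0.
(* The edges outside the first n; with these opened, the event depends on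
   finitely many edges only. *)
pose far n : set (zedge d) := [set e | (n <= choice.pickle e)%N].
pose B (M n : nat) := [set c : zedge d -> bool |
  exists f, bounded_flow q o M%:R ([set e | c e] `|` far n) f].
have -> : [set c : zedge d -> bool | carries_flow q o [set e | c e]] =
    \bigcup_M \bigcap_n B M n.
  apply/seteqP; split=> c /=.
    move=> /carries_flowP-/(_ q0)[M [f hf]]; exists M => // n _; exists f.
    by apply: bounded_flow_mono hf; exact: subsetUl.
  move=> [M _ hM]; apply/carries_flowP => //; exists M.
  by apply: bounded_flow_limit => // n; exact: hM.
apply: (@bigcupT_measurable _ (g_sigma_algebraType cylinders)) => M.
apply: (@bigcapT_measurable _ (g_sigma_algebraType cylinders)) => n.
apply: (@config_event_cylinder (pmap choice.unpickle (iota 0 n))).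
move=> c c' cc' [f hf]; exists f.
apply: bounded_flow_mono hf => e [ce|]; last by right.
have [en|en] := leqP n (choice.pickle e); [by right|left].
rewrite /= -cc'// mem_pmap; apply/mapP; exists (choice.pickle e).
  by rewrite mem_iota.
by rewrite choice.pickleK.
Qed.

End ConfigEvent.

(** * Failure of disjoint families of edges *)

Section DisjointRoutes.
Variables (R : realType) (d : nat) (dT : measure_display) (T : measurableType dT).
Variables (P : probability T R) (p : R) (X : zedge d -> T -> bool).
Hypothesis hX : bernoulli_field P p X.

Lemma measurable_open e : measurable [set w | X e w].
Proof.
have [mX _ _] := hX; have := mX e measurableT [set true] I.
by rewrite setTI.
Qed.

Lemma measurable_all_open (s : seq (zedge d)) :
  measurable [set w | all (X^~ w) s].
Proof.
elim: s => [|e s IH].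
  by rewrite [X in measurable X](_ : _ = setT)//; apply/seteqP; split.
have -> : [set w | all (X^~ w) (e :: s)] =
    [set w | X e w] `&` [set w | all (X^~ w) s].
  by apply/seteqP; split=> w /= => [/andP[]|[-> ->]].
by apply: measurableI => //; exact: measurable_open.
Qed.

Lemma probability_all_open (s : seq (zedge d)) : uniq s ->
  P [set w | all (X^~ w) s] = (p ^+ size s)%:E.
Proof.
move=> us; have [_ Xp indep] := hX.
have := indep [fset e | e in s]%fset.
have -> : \bigcap_(e in [set` [fset e | e in s]%fset]) [set w | X e w] =
    [set w | all (X^~ w) s].
  apply/seteqP; split=> w /=.
    by move=> h; apply/allP => e es; apply: h; rewrite /= inE.
  by move=> /allP h e /=; rewrite inE => /h.
move=> ->; under eq_bigr do rewrite Xp.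
rewrite prodEFin; congr (_%:E).
rewrite (perm_big s) ?big_const_seq ?count_predT ?iter_mulr_1//.
by apply: uniq_perm => // [|e]; [exact: fset_uniq|rewrite inE].
Qed.

Lemma measurable_none_open (L : seq (seq (zedge d))) :
  measurable [set w | all (fun s => ~~ all (X^~ w) s) L].
Proof.
elim: L => [|s L IH].
  by rewrite [X in measurable X](_ : _ = setT)//; apply/seteqP; split.
have -> : [set w | all (fun s => ~~ all (X^~ w) s) (s :: L)] =
    ~` [set w | all (X^~ w) s] `&` [set w | all (fun s => ~~ all (X^~ w) s) L].
  by apply/seteqP; split=> w /= => [/andP[/negP]|[/negP-> ->]].
by apply: measurableI => //; apply: measurableC; exact: measurable_all_open.
Qed.

(** The independence hypothesis speaks of open edges only. The failure of the
families in L is reached by induction, removing from the event without the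
condition on the first family the event where that family is open; the latter
is of the same form with the family added to t, which is why t is there. *)
Lemma probability_none_open (t : seq (zedge d)) (L : seq (seq (zedge d))) :
  uniq (t ++ flatten L) ->
  P ([set w | all (X^~ w) t] `&` [set w | all (fun s => ~~ all (X^~ w) s) L]) =
  (p ^+ size t * \prod_(s <- L) (1 - p ^+ size s))%:E.
Proof.
elim: L t => [|s L IH] t /=.
  rewrite cats0 => ut; rewrite big_nil mulr1 -probability_all_open//.
  by congr (P _); apply/seteqP; split=> w //= -[].
move=> uts; have uts' : uniq ((t ++ s) ++ flatten L) by rewrite -catA.
have ut : uniq (t ++ flatten L).
  apply: subseq_uniq uts; apply: cat_subseq => //; exact: suffix_subseq.
pose A := [set w | all (X^~ w) t] `&` [set w | all (fun s => ~~ all (X^~ w) s) L].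
pose B := [set w | all (X^~ w) s].
have mA : measurable A.
  by apply: measurableI; [exact: measurable_all_open|exact: measurable_none_open].
have mB : measurable B by exact: measurable_all_open.
have -> : [set w | all (X^~ w) t] `&`
    [set w | ~~ all (X^~ w) s && all (fun s => ~~ all (X^~ w) s) L] = A `\` B.
  apply/seteqP; split=> w /=; last by move=> [[-> ->] /negP ->].
  by move=> [ht /andP[/negP hs hL]].
have -> : P (A `\` B) = (P A - P (A `&` B))%E.
  apply: measureD => //; rewrite -ge0_fin_numE//; exact: fin_num_measure.
have -> : A `&` B =
    [set w | all (X^~ w) (t ++ s)] `&` [set w | all (fun s => ~~ all (X^~ w) s) L].
  apply/seteqP; split=> w; rewrite /A /B /= all_cat.
    by move=> [[-> ->] ->].
  by move=> [/andP[-> ->] ->].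
rewrite !IH// -EFinB big_cons size_cat exprD; congr (_%:E); ring.
Qed.

End DisjointRoutes.

(** * The probability of being repairable *)

Section Repairable.
Variables (d : nat).
Implicit Types e : zedge d.

Definition codes e : seq (route_code d) :=
  None :: [seq Some jb | jb <- enum [pred jb : 'I_d * bool | jb.1 != e.2]].

Lemma mem_codes e c : (c \in codes e) = valid_code e c.
Proof.
rewrite inE; case: c => [[j b]|] //=.
by rewrite mem_map ?mem_enum// => x y [].
Qed.

Lemma codes_uniq e : uniq (codes e).
Proof.
rewrite /= map_inj_uniq ?enum_uniq ?andbT => [|x y []//].
by apply/mapP => -[].
Qed.

Lemma flatten_uniq (A B : eqType) (F : A -> seq B) (s : seq A) : uniq s ->
  {in s, forall x, uniq (F x)} ->
  {in s &, forall x y b, b \in F x -> b \in F y -> x = y} ->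
  uniq (flatten [seq F x | x <- s]).
Proof.
elim: s => //= x s IH /andP[xs us] uF dF; rewrite cat_uniq uF ?mem_head//=.
rewrite IH => // [|y ys|y z ys zs]; first 1 last.
- by apply: uF; rewrite inE ys orbT.
- by apply: dF; rewrite inE ?ys ?zs orbT.
rewrite andbT; apply/hasPn => b /flattenP[_ /mapP[y ys ->] bF].
apply/negP => bx; move: xs; rewrite (dF x y _ _ b)//= ?ys ?mem_head//.
by rewrite inE ys orbT.
Qed.

Lemma repairableE (T : Type) (opn : zedge d -> T -> bool) e w :
  repairable opn e w = has (fun c => all (opn^~ w) (code_edges e c)) (codes e).
Proof.
apply/asboolP/hasP => [[g /candidateP[c okc ->] og]|[c]].
  exists c; first by rewrite mem_codes.
  by apply/allP => a /belongs_code/og.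
rewrite mem_codes => okc /allP oc; exists (code_route e c).
  by apply/candidateP; exists c.
by move=> a /belongs_code/oc.
Qed.

Variables (R : realType) (dT : measure_display) (T : measurableType dT).
Variables (P : probability T R) (p : R) (opn : zedge d -> T -> bool).
Hypothesis hX : bernoulli_field P p opn.

Let unrepairableE e : ~` [set w | repairable opn e w] =
  [set w | all (fun s => ~~ all (opn^~ w) s) [seq code_edges e c | c <- codes e]].
Proof.
apply/seteqP; split=> w; rewrite /= repairableE all_map.
  by move/negP; rewrite -all_predC.
by move=> h; apply/negP; rewrite -all_predC.
Qed.

Lemma measurable_repairable : measurable_field (repairable opn).
Proof.
move=> e; apply: (measurable_fun_bool true); rewrite setTI.
rewrite -[X in measurable X]setCK; apply: measurableC.
have := unrepairableE e; rewrite /preimage /= => ->.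
exact: (measurable_none_open hX [seq code_edges e c | c <- codes e]).
Qed.

Lemma probability_repairable e :
  P [set w | repairable opn e w] =
  (1 - (1 - p) * (1 - p ^+ 3) ^+ (2 * (d - 1)))%:E.
Proof.
rewrite -[X in P X]setCK probability_setC; last first.
  rewrite unrepairableE; exact: (measurable_none_open hX).
rewrite unrepairableE.
have := @probability_none_open _ _ _ _ _ _ _ hX [::]
  [seq code_edges e c | c <- codes e].
rewrite expr0 mul1r.
have -> : [set w | all (opn^~ w) [::]] = setT by apply/seteqP; split.
rewrite setTI => ->; last first.
  apply: flatten_uniq; first exact: codes_uniq.
    by move=> c; rewrite mem_codes => /code_edges_uniq.
  move=> c c'; rewrite !mem_codes => okc okc' b; exact: code_edges_disjoint.
rewrite -EFinB big_map big_cons /= expr1 big_map big_enum /=.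
congr (1 - _ * _)%:E.
transitivity (\prod_(jb in [pred jb : 'I_d * bool | jb.1 != e.2]) (1 - p ^+ 3)).
  by apply: eq_bigr => -[].
rewrite prodr_const; congr (_ ^+ _).
rewrite (eq_card (_ : _ =i [predX predC1 e.2 & xpredT])); last first.
  by move=> [j b]; rewrite !inE andbT.
by rewrite cardX cardC1 card_ord card_bool mulnC subn1.
Qed.

End Repairable.

(** * Repairing a flow *)

Section Repair.
Variables (R : realType) (d : nat) (q : R) (o : vertex d).

Lemma repair_carries_flow (F G : set (zedge d)) : 1 <= q ->
  (forall e, F e -> exists2 g, candidate e g & route_open G g) ->
  carries_flow q o F -> carries_flow q o G.
Proof.
move=> q1 FG [theta [utheta fin]].
have /choice[gamma hg] : forall e, exists g,
    F e -> candidate e g /\ route_open G g.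
  move=> e; have [Fe|nFe] := pselect (F e); last by exists [::].
  by have [g ? ?] := FG e Fe; exists g.
have [fl _ _] := utheta.
have cand e : F e -> candidate e (gamma e) by case/hg.
have ropen e : F e -> route_open G (gamma e) by case/hg.
have ulift := lift_unit_flow fl cand ropen utheta.
exists (lift_flow F gamma theta); split=> //.
apply: le_lt_trans (_ : _ <= energy q setT (lift_flow F gamma theta))%E _.
  rewrite /energy esum_mkcond; apply: le_esum => e _.
  by case: ifP => // _; rewrite lee_fin powR_ge0.
apply: (le_lt_trans (lift_energy fl cand q1)).
have e0 : (0 <= energy q F theta)%E.
  by apply: esum_ge0 => e _; rewrite lee_fin powR_ge0.
by apply: lte_mul_pinfty => //; rewrite lee_fin mulr_ge0 ?powR_ge0.
Qed.

Lemma component_carries_flow (F : set (zedge d)) : 0 < q ->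
  carries_flow q o (component F o) -> carries_flow q o F.
Proof. by move=> q0; apply: carries_flow_mono => // e []. Qed.

End Repair.

Theorem corollary5p5 (R : realType) (d : nat) (o : vertex d) (q r p : R)
    (hd : (3 <= d)%N) (hq : d%:R / (d%:R - 1) < q) (hr : 0 < r < 1)
    (hp : 0 <= p <= 1)
    (rho : nat -> R -> R)
    (hrho : forall (k : nat) (s : R), 0 < s < 1 ->
       lss_threshold d k s (rho k s))
    (dB : measure_display) (OB : measurableType dB) (PB : probability OB R)
    (X : zedge d -> OB -> bool) (hX : bernoulli_field PB r X)
    (hflow : with_positive_probability PB
       [set w | carries_flow q o (component (open_edges X w) o)])
    (dH : measure_display) (OH : measurableType dH) (PH : probability OH R)
    (opn : zedge d -> OH -> bool) (hopn : bernoulli_field PH p opn)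
    (Rd : nat) (hRd : dependent_range PH Rd (repairable opn))
    (hpr : rho Rd r <= 1 - (1 - p) * (1 - p ^+ 3) ^+ (2 * (d - 1))) :
  with_positive_probability PH [set w | carries_flow q o (open_edges opn w)] /\
  (forall (dC : measure_display) (OC : measurableType dC)
     (PC : probability OC R) (opn' omega : zedge d -> OC -> bool),
     bernoulli_field PC p opn' -> bernoulli_field PC r omega ->
     {ae PC, forall w, forall e, omega e w -> repairable opn' e w} ->
     {ae PC, forall w,
       let D := component (open_edges omega w) o in
       forall theta : vertex d -> vertex d -> R,
         finite_energy_unit_flow q D o theta ->
       forall gamma : zedge d -> route d,
         (forall e, D e ->
            candidate e (gamma e) /\
            route_open (open_edges opn' w) (gamma e)) ->
         (energy q setT (lift_flow D gamma theta) <=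
            (3 * Kd R d `^ (q - 1))%:E * energy q D theta)%E}).
Proof.
have q1 : 1 <= q.
  apply: ltW; apply: le_lt_trans hq.
  rewrite ler_pdivlMr ?mul1r ?gerBl//.
  by rewrite subr_gt0 (ltr_nat R 1 d) (leq_trans _ hd).
have q0 : 0 < q := lt_le_trans ltr01 q1.
split; last first.
  move=> dC OC PC opn' omega _ _ _; apply: aeW => w theta [[fl _ _] _] gamma hg.
  by apply: lift_energy => // e /hg[].
have [B [mB sB PB0]] := hflow.
pose A := [set c : zedge d -> bool | carries_flow q o [set e | c e]].
have mA : config_event A by exact: config_event_carries_flow.
have incA : increasing_event A.
  by move=> c c' cc'; apply: carries_flow_mono => // e /cc'.
have mY := measurable_repairable hopn.
have dom : stoch_dominates PH (repairable opn) PB X.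
  apply: (hrho Rd r hr).2 => // e.
  by rewrite (probability_repairable hopn) lee_fin.
exists [set w | A (fun e => repairable opn e w)]; split.
- exact: measurable_field_event.
- move=> w; apply: repair_carries_flow => // e.
  by move=> /asboolP[g ? ?]; exists g.
apply: (lt_le_trans PB0); apply: le_trans (dom _ mA incA).
have [mX _ _] := hX; apply: le_measure; rewrite ?inE//.
  exact: measurable_field_event.
by move=> w /sB; exact: component_carries_flow.
Qed.
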